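(* Let $(M,L_1,L_2)$ be a generalized almost Kähler manifold, with bi-Hermitian data $(g,b,J_+,J_-)$, such that $J_++J_-$ and $J_+-J_-$ are invertible. If $\varphi:M\to M$ is a diffeomorphism then any two of the following assertions imply the third: (i) $\varphi:(M,L_1)\to(M,L_1)$ is holomorphic. (ii) $\varphi:(M,L_2)\to(M,L_2)$ is holomorphic. (iii) $[d\varphi,J_+J_-]=0$.
   Context: Manifolds are connected and smooth. For a real vector space $V$, $E\subseteq V^{\mathbb C}$ and $\varepsilon\in\Lambda^2E^*$, $L(E,\varepsilon)=\{u+\alpha\in V^{\mathbb C}\oplus(V^{\mathbb C})^*\mid u\in E,\ \alpha|_E=\varepsilon(u,\cdot)\}$. A linear generalized complex structure on $V$ is a maximal isotropic subspace $L$ of $V^{\mathbb C}\oplus(V^{\mathbb C})^*$ (for $\langle u+\alpha,v+\beta\rangle=\tfrac12(\alpha(v)+\beta(u))$) with $L\cap\overline L=\{0\}$; then $L=L(E,\varepsilon)$ for a unique pair; its associated co-CR structure is $E$ and its associated Poisson structure is $L(E\cap\overline E,\mathrm{Im}(\varepsilon|_{E\cap\overline E}))$ (regarded on the real subspace with complexification $E\cap\overline E$), the graph of a bivector on $V$. A linear map is generalized complex linear if $f(E_V)\subseteq E_W$ and $f$ maps the bivector of $V$ to that of $W$. A generalized almost complex structure on $M$ is a complex subbundle $L$ of $T^{\mathbb C}M\oplus(T^{\mathbb C}M)^*$ which is pointwise a linear generalized complex structure; $\mathcal J$ denotes the corresponding section of $\mathrm{End}(TM\oplus T^*M)$ with $\mathrm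 i$-eigenbundle $L$. A map between generalized almost complex manifolds is holomorphic if its differential at each point is generalized complex linear. A generalized almost Kähler manifold $(M,L_1,L_2)$ has two generalized almost complex structures whose $\mathcal J_1,\mathcal J_2$ commute and $\mathcal J_1\mathcal J_2$ is negative definite with respect to $\langle\cdot,\cdot\rangle$. These correspond bijectively to quadruples $(g,b,J_+,J_-)$, with $g$ a Riemannian metric, $b$ a two-form and $J_\pm$ almost Hermitian structures on $(M,g)$, via $L_1=L^+\oplus L^-$, $L_2=L^+\oplus\overline{L^-}$, $L^\pm=\{X+(b\pm g)(X)\mid X\in V^\pm\}$, $V^\pm$ the $\mathrm i$-eigenbundles of $J_\pm$. Condition (iii) means $d\varphi\circ(J_+J_-)=(J_+J_-)\circ d\varphi$ as bundle maps $TM\to TM$ covering $\varphi$. *)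

(* Defs.v *)
From HB Require Import structures.
From mathcomp Require Import all_boot all_order all_algebra.
From mathcomp Require Import complex.
From mathcomp Require Import all_classical all_reals all_analysis.
Set Implicit Arguments.
Unset Strict Implicit.
Unset Printing Implicit Defensive.
Import Order.TTheory GRing.Theory Num.Theory.
Import numFieldNormedType.Exports.
Local Open Scope classical_set_scope.
Local Open Scope ring_scope.

(* Vectors and covectors of an n-dimensional space are both row vectors: the
   covector a takes the value  v *m a^T  on the vector v, and an element u + a
   of V (+) V^* is  row_mx u a.  A linear map f is the matrix D acting by
   v |-> v *m D, so that f o g has matrix  Mg *m Mf.  A bilinear form h is the
   matrix with h(u, v) = u *m h *m v^T, and the covector h(u, -) is u *m h.
   Subspaces are row spaces of matrices, compared by the
   relations of the scope %MS. *)

Definition covector_at (K : fieldType) n (a v : 'rV[K]_n) : K :=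
  (v *m a^T) 0 0.

Definition gpairing (K : fieldType) n (w w' : 'rV[K]_(n + n)) : K :=
  2^-1 * (covector_at (rsubmx w) (lsubmx w')
        + covector_at (rsubmx w') (lsubmx w)).

Definition isotropic (K : fieldType) n (L : 'M[K]_(n + n)) : Prop :=
  forall w w' : 'rV_(n + n),
    (w <= L)%MS -> (w' <= L)%MS -> gpairing w w' = 0.

Definition max_isotropic (K : fieldType) n (L : 'M[K]_(n + n)) : Prop :=
  isotropic L /\
  forall L' : 'M[K]_(n + n), isotropic L' -> (L <= L')%MS -> (L' <= L)%MS.

Definition cplx (R : realType) m n (A : 'M[R]_(m, n)) : 'M[R[i]]_(m, n) :=
  map_mx (real_complex R) A.

Definition conj_mx (R : realType) m n (A : 'M[R[i]]_(m, n)) :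
    'M[R[i]]_(m, n) :=
  map_mx (@conjc R) A.

Definition linear_gcs (R : realType) n (L : 'M[R[i]]_(n + n)) : Prop :=
  max_isotropic L /\ (L :&: conj_mx L == (0 : 'M[R[i]]_(n + n)))%MS.

(* Only the values of e on E matter. *)
Definition two_form_on (K : fieldType) n (E : set 'rV[K]_n)
    (e : 'rV[K]_n -> 'rV[K]_n -> K) : Prop :=
  [/\ forall k u v w, E u -> E v -> E w ->
        e (k *: u + v) w = k * e u w + e v w,
      forall k u v w, E u -> E v -> E w ->
        e w (k *: u + v) = k * e w u + e w v &
      forall u, E u -> e u u = 0].

Definition Lgraph (K : fieldType) n (E : set 'rV[K]_n)
    (e : 'rV[K]_n -> 'rV[K]_n -> K) : set ('rV[K]_n * 'rV[K]_n) :=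
  [set w | E w.1 /\ forall v, E v -> covector_at w.2 v = e w.1 v].

Definition is_L (R : realType) n (L : 'M[R[i]]_(n + n)) (E : 'M[R[i]]_n)
    (e : 'rV[R[i]]_n -> 'rV[R[i]]_n -> R[i]) : Prop :=
  two_form_on [set u : 'rV_n | (u <= E)%MS] e /\
  forall u a : 'rV_n, (row_mx u a <= L)%MS <->
    Lgraph [set u : 'rV_n | (u <= E)%MS] e (u, a).

Definition assoc_poisson (R : realType) n (E : 'M[R[i]]_n)
    (e : 'rV[R[i]]_n -> 'rV[R[i]]_n -> R[i]) : set ('rV[R]_n * 'rV[R]_n) :=
  Lgraph [set x : 'rV[R]_n | (cplx x <= E :&: conj_mx E)%MS]
         (fun x y => complex.Im (e (cplx x) (cplx y))).

(* The bivector P is the alternating form  (a, b) |-> a *m P *m b^T  on V^*;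
   its graph is { P(a, -) + a }. *)
Definition bivector_graph (R : realType) n
    (L : set ('rV[R]_n * 'rV[R]_n)) (P : 'M[R]_n) : Prop :=
  P^T = - P /\ forall x a : 'rV_n, L (x, a) <-> x = a *m P.

(* f_* P is the form (a, b) |-> P(f^* a, f^* b), where f^* a = a *m D^T. *)
Definition gc_linear (R : realType) n m (LV : 'M[R[i]]_(n + n))
    (LW : 'M[R[i]]_(m + m)) (D : 'M[R]_(n, m)) : Prop :=
  exists EV eV PV EW eW PW,
    [/\ is_L LV EV eV, bivector_graph (assoc_poisson EV eV) PV,
        is_L LW EW eW & bivector_graph (assoc_poisson EW eW) PW] /\
    ((EV *m cplx D <= EW)%MS /\ D^T *m PV *m D = PW).

(* J is the real endomorphism of V (+) V^* with i-eigenspace L. *)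
Definition gcs_endo (R : realType) n (L : 'M[R[i]]_(n + n))
    (J : 'M[R]_(n + n)) : Prop :=
  (eigenspace (cplx J) 'i%C == L)%MS.

Fixpoint Ck_on (R : realType) n (W : normedModType R) (k : nat)
    (U : set 'rV[R]_n) (f : 'rV[R]_n -> W) : Prop :=
  match k with
  | 0 => forall x, U x -> {for x, continuous f}
  | k'.+1 => (forall x, U x -> differentiable f x) /\
             forall v : 'rV[R]_n, Ck_on k' U (fun x => 'D_v f x)
  end.

(* Used only for open U. *)
Definition smooth_on (R : realType) n (W : normedModType R)
    (U : set 'rV[R]_n) (f : 'rV[R]_n -> W) : Prop :=
  forall k, Ck_on k U f.

(* The values of cmap outside cdom, and of cinv outside ccod, are junk. *)
Record chart (R : realType) n (M : topologicalType) := Chart {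
  cdom : set M;
  ccod : set 'rV[R]_n;
  cmap : M -> 'rV[R]_n;
  cinv : 'rV[R]_n -> M;
  cdom_open : open cdom;
  ccod_open : open ccod;
  cmap_cod : forall p, cdom p -> ccod (cmap p);
  cinv_dom : forall x, ccod x -> cdom (cinv x);
  cmapK : forall p, cdom p -> cinv (cmap p) = p;
  cinvK : forall x, ccod x -> cmap (cinv x) = x;
  cmap_cont : forall p, cdom p -> {for p, continuous cmap};
  cinv_cont : forall x, ccod x -> {for x, continuous cinv} }.

(* An atlas together with a preferred chart at every point. *)
Record manifold (R : realType) n := Manifold {
  carrier :> topologicalType;
  mfd_hausdorff : hausdorff_space carrier;
  mfd_second_countable : @second_countable carrier;
  mfd_connected : connected [set: carrier];
  atlas : set (chart R n carrier);
  chart_at : carrier -> chart R n carrier;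
  chart_at_atlas : forall p, atlas (chart_at p);
  chart_at_dom : forall p, cdom (chart_at p) p;
  atlas_compat : forall c c', atlas c -> atlas c' ->
    smooth_on (cmap c @` (cdom c `&` cdom c')) (cmap c' \o cinv c) }.

Definition smooth_map (R : realType) n m (M : manifold R n) (N : manifold R m)
    (f : M -> N) : Prop :=
  continuous f /\
  forall (c : chart R n M) (c' : chart R m N), atlas c -> atlas c' ->
    smooth_on (cmap c @` (cdom c `&` f @^-1` cdom c'))
              (cmap c' \o f \o cinv c).

Definition diffeomorphism (R : realType) n m (M : manifold R n)
    (N : manifold R m) (f : M -> N) : Prop :=
  smooth_map f /\
  exists2 h : N -> M, smooth_map h & cancel f h /\ cancel h f.

(* T_p M is 'rV_n, a vector being given by its components in chart_at p. *)
Definition differential (R : realType) n m (M : manifold R n)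
    (N : manifold R m) (f : M -> N) (p : M) : 'M[R]_(n, m) :=
  jacobian (cmap (chart_at (f p)) \o f \o cinv (chart_at p))
           (cmap (chart_at p) p).

(* If q is in the domain of c, v *m tangent_coord c q lists the components in c
   of the vector v of T_q M. *)
Definition tangent_coord (R : realType) n (M : manifold R n) (c : chart R n M)
    (q : M) : 'M[R]_n :=
  jacobian (cmap c \o cinv (chart_at q)) (cmap (chart_at q) q).

(* F c q is the matrix of components in the chart c of a field at q. *)
Definition smooth_components (R : realType) n (M : manifold R n) k l
    (U : set M) (F : chart R n M -> M -> 'M[R]_(k, l)) : Prop :=
  forall c : chart R n M, atlas c ->
    smooth_on (cmap c @` (cdom c `&` U)) (F c \o cinv c).

Definition smooth_bilinear (R : realType) n (M : manifold R n)
    (h : M -> 'M[R]_n) : Prop :=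
  smooth_components [set: M] (fun c q =>
    let B := invmx (tangent_coord c q) in B *m h q *m B^T).

Definition smooth_endo (R : realType) n (M : manifold R n)
    (J : M -> 'M[R]_n) : Prop :=
  smooth_components [set: M] (fun c q =>
    let A := tangent_coord c q in invmx A *m J q *m A).

(* Covectors change coordinates by the inverse transpose. *)
Definition gtangent_coord (R : realType) n (M : manifold R n)
    (c : chart R n M) (q : M) : 'M[R]_(n + n) :=
  let A := tangent_coord c q in block_mx A 0 0 (invmx A)^T.

(* The rows of F are k sections of T^C M (+) (T^C M)^*. *)
Definition smooth_gsections (R : realType) n (M : manifold R n) k (U : set M)
    (F : M -> 'M[R[i]]_(k, n + n)) : Prop :=
  smooth_components U (fun c q =>
    map_mx (@complex.Re R) (F q *m cplx (gtangent_coord c q))) /\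
  smooth_components U (fun c q =>
    map_mx (@complex.Im R) (F q *m cplx (gtangent_coord c q))).

Definition complex_subbundle (R : realType) n (M : manifold R n)
    (L : M -> 'M[R[i]]_(n + n)) : Prop :=
  exists k, forall p : M, exists U : set M, exists F : M -> 'M[R[i]]_(k, n + n),
    [/\ open U, U p, smooth_gsections U F &
        forall q, U q -> row_free (F q) /\ (F q == L q)%MS].

Definition gen_almost_complex (R : realType) n (M : manifold R n)
    (L : M -> 'M[R[i]]_(n + n)) : Prop :=
  complex_subbundle L /\ forall p, linear_gcs (L p).

Definition gc_holomorphic (R : realType) n m (M : manifold R n)
    (LM : M -> 'M[R[i]]_(n + n)) (N : manifold R m)
    (LN : N -> 'M[R[i]]_(m + m)) (f : M -> N) : Prop :=
  smooth_map f /\ forall p, gc_linear (LM p) (LN (f p)) (differential f p).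

Definition gen_almost_Kahler (R : realType) n (M : manifold R n)
    (L1 L2 : M -> 'M[R[i]]_(n + n)) : Prop :=
  [/\ gen_almost_complex L1, gen_almost_complex L2 &
      exists J1 J2 : M -> 'M[R]_(n + n), forall p,
        [/\ gcs_endo (L1 p) (J1 p), gcs_endo (L2 p) (J2 p),
            J1 p *m J2 p = J2 p *m J1 p &
            forall w : 'rV_(n + n), w != 0 ->
              gpairing (w *m J2 p *m J1 p) w < 0]].

Definition riemannian_metric (R : realType) n (M : manifold R n)
    (g : M -> 'M[R]_n) : Prop :=
  smooth_bilinear g /\
  forall p, (g p)^T = g p /\
    forall v : 'rV_n, v != 0 -> 0 < (v *m g p *m v^T) 0 0.

Definition two_form (R : realType) n (M : manifold R n)
    (b : M -> 'M[R]_n) : Prop :=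
  smooth_bilinear b /\ forall p, (b p)^T = - b p.

Definition almost_hermitian (R : realType) n (M : manifold R n)
    (g J : M -> 'M[R]_n) : Prop :=
  smooth_endo J /\
  forall p, J p *m J p = - 1%:M /\ J p *m g p *m (J p)^T = g p.

(* { X + h(X, -) | X in the i-eigenspace of J } *)
Definition eigen_graph (R : realType) n (J h : 'M[R]_n) :
    'M[R[i]]_(n, n + n) :=
  eigenspace (cplx J) 'i%C *m row_mx 1%:M (cplx h).

Definition bihermitian_data (R : realType) n (M : manifold R n)
    (L1 L2 : M -> 'M[R[i]]_(n + n)) (g b Jp Jm : M -> 'M[R]_n) : Prop :=
  [/\ riemannian_metric g, two_form b,
      almost_hermitian g Jp, almost_hermitian g Jm &
      forall p,
        let Lp := eigen_graph (Jp p) (b p + g p) in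
        let Lm := eigen_graph (Jm p) (b p - g p) in
        [/\ (L1 p == Lp + Lm)%MS, mxdirect (Lp + Lm),
            (L2 p == Lp + conj_mx Lm)%MS & mxdirect (Lp + conj_mx Lm)]].

(* Main.v *)
(* Since J+ - J- and J+ + J- are invertible, the i-eigenspaces of J+ and of
   J- (respectively -J-) span the complexified tangent space, so both L1 and L2
   are graphs of complex two-forms B + i w.  Matching the values on the two
   eigenspaces gives (J+ - J-) w1 = 2 g and (J+ + J-) w2 = 2 g, so the
   associated bivectors are P1 = g^-1 (J+ - J-) / 2 and
   P2 = g^-1 (J+ + J-) / 2.  Holomorphy of phi just says that D = d(phi)
   transports these (which forces D to be invertible), and P1^-1 P2 is the
   Cayley transform of J- J+, as matrices acting on row vectors. *)
Require Import Defs.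
From mathcomp Require Import all_boot all_order all_algebra.
From mathcomp Require Import complex.
From mathcomp Require Import all_classical all_reals all_analysis.
Import Order.TTheory GRing.Theory Num.Theory.
Local Open Scope ring_scope.

(** * Inverses of negatives and of products *)

Lemma unitmxN (K : fieldType) n (A : 'M[K]_n) :
  (- A \in unitmx) = (A \in unitmx).
Proof. by rewrite -scaleN1r unitmxZ ?unitrN1. Qed.

Lemma invmxN (K : fieldType) n (A : 'M[K]_n) : A \in unitmx ->
  invmx (- A) = - invmx A.
Proof.
by move=> uA; rewrite -scaleN1r invmxZ ?scaleN1r ?unitmxN // invrN1 scaleN1r.
Qed.

Lemma invmxM (K : fieldType) n (A B : 'M[K]_n) :
  A \in unitmx -> B \in unitmx -> invmx (A *m B) = invmx B *m invmx A.
Proof.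
move=> uA uB; have uAB : A *m B \in unitmx by rewrite unitmx_mul uA.
by rewrite -[RHS](mulmxK uAB) mulmxA mulmxKV // mulVmx // mul1mx.
Qed.

(** * Complexified matrices and eigenspaces of complex structures *)

Section ComplexGraph.
Context {R : realType}.
Implicit Types n m : nat.

Lemma cplxM m n p (A : 'M[R]_(m, n)) (B : 'M[R]_(n, p)) :
  cplx (A *m B) = cplx A *m cplx B.
Proof. exact: map_mxM. Qed.

Lemma cplxD m n (A B : 'M[R]_(m, n)) : cplx (A + B) = cplx A + cplx B.
Proof. exact: map_mxD. Qed.

Lemma cplxN m n (A : 'M[R]_(m, n)) : cplx (- A) = - cplx A.
Proof. exact: map_mxN. Qed.

Lemma cplx1 n : cplx (1%:M : 'M[R]_n) = 1%:M.
Proof. exact: map_mx1. Qed.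

Lemma cplxT m n (A : 'M[R]_(m, n)) : cplx A^T = (cplx A)^T.
Proof. by rewrite /cplx map_trmx. Qed.

Lemma conj_cplx m n (A : 'M[R]_(m, n)) : conj_mx (cplx A) = cplx A.
Proof. by apply/matrixP => i j; rewrite !mxE /= oppr0. Qed.

Lemma im_cplx_entry (r s : R) :
  complex.Im ((real_complex R r + 'i%C * real_complex R s)%R : R[i]) = s.
Proof. by rewrite /= !(mul0r, mul1r, mulr0, addr0, add0r). Qed.

Lemma sqr_iC : 'i%C * 'i%C = -1 :> R[i].
Proof. by rewrite -expr2 sqr_i. Qed.

(** The matrix 1 - iJ is twice the projection onto the i-eigenspace: it doubles every eigenvector,
    and its own rows are eigenvectors because J^2 = -1. *)
Lemma eigenspace_complex_structure n (J : 'M[R]_n) : J *m J = - 1%:M ->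
  (eigenspace (cplx J) 'i%C :=: 1%:M - 'i%C *: cplx J)%MS.
Proof.
move=> JJ; apply/eqmxP/andP; split; last first.
  apply/eigenspaceP.
  rewrite mulmxBl mul1mx -scalemxAl -cplxM JJ cplxN cplx1 scalerN opprK.
  by rewrite scalerBr scalerA sqr_iC scaleN1r opprK addrC.
have /eigenspaceP EJ := submx_refl (eigenspace (cplx J) 'i%C).
set W := eigenspace _ _ in EJ *.
have W2 : W *m (1%:M - 'i%C *: cplx J) = 2 *: W.
  rewrite mulmxBr mulmx1 -scalemxAr EJ scalerA sqr_iC scaleN1r opprK.
  by rewrite scaler_nat mulr2n.
have two0 : (2 : R[i]) != 0 by rewrite pnatr_eq0.
by rewrite -(scalerK two0 W) -W2 scalemx_sub // submxMl.
Qed.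

Lemma covector_inj (K : fieldType) n (a a' : 'rV[K]_n) :
  (forall v, covector_at a v = covector_at a' v) -> a = a'.
Proof.
move=> h; apply/rowP => j; have := h (delta_mx 0 j).
by rewrite /covector_at -!rowE !mxE.
Qed.

Lemma im_covector n (B w : 'M[R]_n) (x y : 'rV[R]_n) :
  complex.Im (covector_at (cplx x *m (cplx B + 'i%C *: cplx w)) (cplx y))
  = covector_at (x *m w) y.
Proof.
rewrite /covector_at mulmxDr -scalemxAr -!cplxM linearD linearZ /= mulmxDr.
rewrite -scalemxAr -!cplxT -!cplxM.
by rewrite mxE [in X in _ + X]mxE ![cplx _ _ _]mxE im_cplx_entry.
Qed.

Lemma row_mx_graph (K : fieldType) n (e : 'M[K]_n) (u a : 'rV[K]_n) :
  (row_mx u a <= row_mx 1%:M e)%MS <-> a = u *m e.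
Proof.
split=> [/submxP[c]|->].
  by rewrite mul_mx_row mulmx1 => /eq_row_mx[-> ->].
by apply/submxP; exists u; rewrite mul_mx_row mulmx1.
Qed.

(** * Generalized complex structures that are graphs of complex two-forms *)

Section Graph.
Context {n : nat} (L : 'M[R[i]]_(n + n)) (B w : 'M[R]_n).
Let e := cplx B + 'i%C *: cplx w.
Hypotheses (Le : (L == row_mx 1%:M e)%MS).

Lemma mem_graph (u a : 'rV[R[i]]_n) : (row_mx u a <= L)%MS <-> a = u *m e.
Proof. by rewrite (eqmxP Le); apply: row_mx_graph. Qed.

(** Uniqueness of the pair (E, e), needed because [gc_linear] only asserts that some pair exists.
    Every u occurs in the graph as u + e(u), so E is everything and e0 is read off from e. *)
Lemma is_L_graph E e0 : is_L L E e0 ->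
  (1%:M <= E)%MS /\ forall u v, e0 u v = covector_at (u *m e) v.
Proof.
move=> [_ LE].
have EE (u : 'rV_n) : (u <= E)%MS.
  by have /LE[] := (mem_graph u (u *m e)).2 erefl.
split=> [|u v]; first by apply/row_subP => i; apply: EE.
by have /LE[_ ->] := (mem_graph u (u *m e)).2 erefl; rewrite //=.
Qed.

Lemma assoc_poisson_graph E e0 : is_L L E e0 ->
  forall x a, assoc_poisson E e0 (x, a) <-> a = x *m w.
Proof.
move=> /is_L_graph[E1 ee] x a.
have EE (z : 'rV[R]_n) : (cplx z <= E :&: conj_mx E)%MS.
  apply: (submx_trans (submx1 _)); rewrite sub_capmx E1 /=.
  have -> : (1%:M : 'M[R[i]]_n) = conj_mx 1%:M by rewrite -cplx1 conj_cplx.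
  by rewrite /conj_mx map_submx.
split=> [[_ /= h]|->].
  by apply: covector_inj => v; rewrite h ?ee ?im_covector //; apply: EE.
by split=> [|v _] /=; [apply: EE | rewrite ee im_covector].
Qed.

Hypothesis (isoL : isotropic L).

Let e_alt u : covector_at (u *m e) u = 0.
Proof.
have wL : (row_mx u (u *m e) <= L)%MS by apply/mem_graph.
have := isoL _ _ wL wL; rewrite /gpairing row_mxKl row_mxKr => /eqP.
by rewrite mulf_eq0 invr_eq0 pnatr_eq0 -mulr2n mulrn_eq0 => /eqP.
Qed.

Lemma graph_is_L : is_L L 1%:M (fun u v => covector_at (u *m e) v).
Proof.
split; first (split=> [k u v x _ _ _|k u v x _ _ _|u _]; last exact: e_alt).
- by rewrite /covector_at mulmxDl -scalemxAl linearD linearZ /= mulmxDr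
    -scalemxAr !mxE.
- by rewrite /covector_at mulmxDl -scalemxAl !mxE.
move=> u a; rewrite mem_graph; split=> [->|[_ /= h]].
  by split=> [|v _] //=; apply: submx1.
by apply: covector_inj => v; apply: h; apply: submx1.
Qed.

(** Isotropy makes e alternating; its imaginary part w then vanishes on the diagonal of real
    vectors, and polarization on basis vectors gives skewness. *)
Lemma graph_skew : w^T = - w.
Proof.
have q0 (x : 'rV[R]_n) : covector_at (x *m w) x = 0.
  by rewrite -(im_covector _ B) e_alt.
apply/matrixP => i j; rewrite !mxE; apply/eqP; rewrite -addr_eq0; apply/eqP.
have ent k l : w k l = covector_at (delta_mx 0 k *m w) (delta_mx 0 l).
  by rewrite /covector_at -rowE -rowE !mxE.
have add00 (X Y : 'M[R]_1) : (X + Y) 0 0 = X 0 0 + Y 0 0 by rewrite mxE.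
have := q0 (delta_mx 0 i + delta_mx 0 j).
rewrite /covector_at mulmxDl linearD /= mulmxDl !mulmxDr !add00.
by rewrite -!/(covector_at _ _) !q0 add0r addr0 -!ent.
Qed.

End Graph.

(** For a graph, E is the whole complexified space, so the inclusion of co-CR structures holds. The
    associated Poisson structure is a = x w, which is the graph of the bivector w^-1; only its
    transport by D remains. *)
Lemma gc_linear_graph n m (LV : 'M[R[i]]_(n + n)) (LW : 'M[R[i]]_(m + m))
    (BV wV : 'M[R]_n) (BW wW : 'M[R]_m) (D : 'M[R]_(n, m)) :
  isotropic LV -> isotropic LW ->
  (LV == row_mx 1%:M (cplx BV + 'i%C *: cplx wV))%MS ->
  (LW == row_mx 1%:M (cplx BW + 'i%C *: cplx wW))%MS ->
  wV \in unitmx -> wW \in unitmx ->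
  gc_linear LV LW D <-> D^T *m invmx wV *m D = invmx wW.
Proof.
(* Each basis vector x is paired with the covector x w in the Poisson structure, hence x = x w P;
   row by row this says w P = 1. *)
have biv k (L : 'M[R[i]]_(k + k)) B w E e P :
    (L == row_mx 1%:M (cplx B + 'i%C *: cplx w))%MS -> w \in unitmx ->
    is_L L E e -> bivector_graph (assoc_poisson E e) P -> P = invmx w.
  move=> Lw wu isL [_ PE].
  have wP : w *m P = 1%:M.
    apply/row_matrixP => i; rewrite !rowE mulmxA mulmx1.
    by apply/esym/PE; apply/(assoc_poisson_graph _ _ _ Lw _ _ isL).
  by rewrite -[P](mulKmx wu) wP mulmx1.
have bivE k (L : 'M[R[i]]_(k + k)) B w :
    isotropic L -> (L == row_mx 1%:M (cplx B + 'i%C *: cplx w))%MS ->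
    w \in unitmx -> exists2 e, is_L L 1%:M e &
      bivector_graph (assoc_poisson 1%:M e) (invmx w).
  move=> isoL Lw wu; eexists; first exact: graph_is_L Lw isoL.
  split; first by rewrite trmx_inv (graph_skew _ _ _ Lw isoL) invmxN.
  move=> x a.
  rewrite (assoc_poisson_graph _ _ _ Lw _ _ (graph_is_L _ _ _ Lw isoL)).
  by split=> ->; rewrite (mulmxK, mulmxKV).
move=> isoV isoW LVw LWw uV uW; split.
  move=> [EV [eV [PV [EW [eW [PW [[LV_ PV_ LW_ PW_] [_]]]]]]]].
  by rewrite (biv _ _ _ _ _ _ _ LVw uV LV_ PV_)
    (biv _ _ _ _ _ _ _ LWw uW LW_ PW_).
move=> DP.
have [eV LV_ PV_] := bivE _ _ _ _ isoV LVw uV.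
have [eW LW_ PW_] := bivE _ _ _ _ isoW LWw uW.
by exists 1%:M, eV, (invmx wV), 1%:M, eW, (invmx wW); rewrite submx1.
Qed.

(** * Graphs over eigenspaces of complex structures *)

Lemma eigen_graphE n (J h : 'M[R]_n) : J *m J = - 1%:M ->
  (eigen_graph J h :=: (1%:M - 'i%C *: cplx J) *m row_mx 1%:M (cplx h))%MS.
Proof. by move=> JJ; apply: eqmxMr; apply: eigenspace_complex_structure. Qed.

(** Conjugation turns 1 - iJ into 1 + iJ and fixes the real matrix h. This lets L2 be treated as L1
    with J- replaced by -J-. *)
Lemma conj_eigen_graph n (J h : 'M[R]_n) : J *m J = - 1%:M ->
  (conj_mx (eigen_graph J h) :=: eigen_graph (- J) h)%MS.
Proof.
move=> JJ.
have JJN : (- J) *m (- J) = - 1%:M by rewrite mulmxN mulNmx opprK.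
apply: eqmx_trans (eqmx_sym (eigen_graphE _ _ h JJN)).
apply: (@eqmx_trans _ _ _ _ _ _
  (conj_mx ((1%:M - 'i%C *: cplx J) *m row_mx 1%:M (cplx h)))).
  apply/eqmxP.
  by rewrite /conj_mx !map_submx !(eigen_graphE _ _ h JJ) submx_refl.
have -> : conj_mx ((1%:M - 'i%C *: cplx J) *m row_mx 1%:M (cplx h))
  = (1%:M - 'i%C *: cplx (- J)) *m row_mx 1%:M (cplx h).
  rewrite /conj_mx map_mxM map_row_mx map_mxB map_mxZ map_mx1.
    rewrite [map_mx _ (cplx J)]conj_cplx [map_mx _ (cplx h)]conj_cplx.
  rewrite [X in X *: _](_ : _ = - 'i%C) ?cplxN ?scalerN ?scaleNr //.
  by apply/eqP; rewrite eq_complex /= oppr0 !eqxx.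
exact: eqmx_refl.
Qed.

(** If u J = iu, then u (h - J w + iw) = u h - iuw + iuw = u h. *)
Lemma eigenvector_graph n (J h w : 'M[R]_n) : J *m J = - 1%:M ->
  (1%:M - 'i%C *: cplx J) *m (cplx (h - J *m w) + 'i%C *: cplx w)
  = (1%:M - 'i%C *: cplx J) *m cplx h.
Proof.
move=> JJ.
have cJJ : cplx J *m cplx J = - 1%:M by rewrite -cplxM JJ cplxN cplx1.
rewrite cplxD cplxN cplxM -addrA mulmxDr.
rewrite [X in _ + X](_ : _ = 0) ?addr0 //.
rewrite mulmxDr mulmxN !mulmxBl !mul1mx -!scalemxAl -!scalemxAr.
rewrite (mulmxA (cplx J) (cplx J)) cJJ mulNmx mul1mx scalerA sqr_iC.
by rewrite scaleN1r scalerN !opprK [X in _ + X]addrC addNr.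
Qed.

Lemma eigenspaces_span n (J1 J2 : 'M[R]_n) : J2 *m J2 = - 1%:M ->
  J1 - J2 \in unitmx ->
  (1%:M <= (1%:M - 'i%C *: cplx J1) + (1%:M - 'i%C *: cplx J2))%MS.
Proof.
move=> JJ2 u12.
(* The solution of A J1 + (1 - A) J2 = 0: with the weights A and 1 - A the imaginary terms cancel
   and the two projections combine to 1. *)
pose A := - (J2 *m invmx (J1 - J2)).
have AJ : A *m J1 + (1%:M - A) *m J2 = 0.
  rewrite mulmxBl mul1mx addrCA -mulmxBr /A mulNmx -mulmxA mulVmx //.
  by rewrite mulmx1 subrr.
have E1 : cplx A *m (1%:M - 'i%C *: cplx J1)
    + cplx (1%:M - A) *m (1%:M - 'i%C *: cplx J2) = 1%:M.
  rewrite !mulmxBr !mulmx1 -!scalemxAr -!cplxM addrACA -opprD -scalerDr.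
  rewrite -!cplxD AJ [A + _]addrC subrK cplx1.
  by rewrite /cplx map_mx0 scaler0 subr0.
by rewrite -[X in (X <= _)%MS]E1 addmx_sub_adds // submxMl.
Qed.

(** The equation for w makes h1 - J1 w equal to h2 - J2 w, so one form e agrees with h1 and h2 on
    the respective eigenspaces. As these span, the sum is the full graph of e. *)
Lemma eigen_graph_sum n (J1 J2 h1 h2 w : 'M[R]_n) :
  J1 *m J1 = - 1%:M -> J2 *m J2 = - 1%:M -> J1 - J2 \in unitmx ->
  (J1 - J2) *m w = h1 - h2 ->
  (eigen_graph J1 h1 + eigen_graph J2 h2 ==
    row_mx 1%:M (cplx (h1 - J1 *m w) + 'i%C *: cplx w))%MS.
Proof.
move=> JJ1 JJ2 u12 hw; set e := cplx _ + 'i%C *: _.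
have B12 : h1 - J1 *m w = h2 - J2 *m w.
  apply/eqP; rewrite subr_eq addrAC -addrA -mulmxBl hw.
  by rewrite addrC subrK.
have S1 : (eigen_graph J1 h1 :=: (1%:M - 'i%C *: cplx J1) *m row_mx 1%:M e)%MS.
  apply: eqmx_trans (eigen_graphE _ _ _ JJ1) _.
  by rewrite !mul_mx_row eigenvector_graph //; apply: eqmx_refl.
have S2 : (eigen_graph J2 h2 :=: (1%:M - 'i%C *: cplx J2) *m row_mx 1%:M e)%MS.
  apply: eqmx_trans (eigen_graphE _ _ _ JJ2) _.
  by rewrite !mul_mx_row /e B12 eigenvector_graph //; apply: eqmx_refl.
apply/eqmxP; apply: eqmx_trans (adds_eqmx S1 S2) _.
apply: eqmx_trans (eqmx_sym (addsmxMr _ _ _)) _.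
apply/eqmxP; rewrite submxMl /= -{1}[row_mx _ _]mul1mx submxMr //.
exact: eigenspaces_span.
Qed.

Lemma posdef_unitmx n (g : 'M[R]_n) :
  (forall v : 'rV_n, v != 0 -> 0 < (v *m g *m v^T) 0 0) -> g \in unitmx.
Proof.
move=> gpos; rewrite -row_free_unit; apply: inj_row_free => v vg.
apply/eqP; apply: contraT => /gpos.
by rewrite vg mul0mx mxE ltxx.
Qed.

Lemma gc_linear_eigen_graphs n (h1 h2 J1 J2 h1' h2' J1' J2' : 'M[R]_n)
    (L L' : 'M[R[i]]_(n + n)) (D : 'M[R]_n) :
  J1 *m J1 = - 1%:M -> J2 *m J2 = - 1%:M ->
  J1' *m J1' = - 1%:M -> J2' *m J2' = - 1%:M ->
  J1 - J2 \in unitmx -> J1' - J2' \in unitmx ->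
  h1 - h2 \in unitmx -> h1' - h2' \in unitmx ->
  isotropic L -> isotropic L' ->
  (L == eigen_graph J1 h1 + eigen_graph J2 h2)%MS ->
  (L' == eigen_graph J1' h1' + eigen_graph J2' h2')%MS ->
  gc_linear L L' D <->
  (D^T *m invmx (h1 - h2)) *m (J1 - J2) *m D = invmx (h1' - h2') *m (J1' - J2').
Proof.
move=> JJ1 JJ2 JJ1' JJ2' u u' uh uh' iso iso' /eqmxP LE /eqmxP LE'.
have inv_w (A B : 'M[R]_n) : A \in unitmx -> B \in unitmx ->
    invmx (invmx A *m B) = invmx B *m A.
  by move=> uA uB; rewrite invmxM ?unitmx_inv // invmxK.
have wu (A B : 'M[R]_n) : A \in unitmx -> B \in unitmx ->
  invmx A *m B \in unitmx by move=> uA uB; rewrite unitmx_mul unitmx_inv uA.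
(* The cancellation [mulKVmx] fixes the implicit w as (J1 - J2)^-1 (h1 - h2), whose inverse is the
   bivector (h1 - h2)^-1 (J1 - J2). *)
have graph := eqmx_trans LE
  (eqmxP (eigen_graph_sum _ _ _ h1 h2 _ JJ1 JJ2 u (mulKVmx u _))).
have graph' := eqmx_trans LE'
  (eqmxP (eigen_graph_sum _ _ _ h1' h2' _ JJ1' JJ2' u'
    (mulKVmx u' _))).
have := gc_linear_graph _ _ _ _ _ _ _ _ D iso iso' (introT eqmxP graph)
  (introT eqmxP graph') (wu _ _ u uh) (wu _ _ u' uh').
by rewrite !inv_w // !mulmxA.
Qed.

End ComplexGraph.

(** * Matrix algebra relating transport of bivectors to intertwining *)

Section Intertwining.
Context {K : fieldType} {n : nat}.
Hypothesis two_neq0 : 2 != 0 :> K.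
Variables (Jp Jm Jp' Jm' A D G : 'M[K]_n).
Hypotheses (JpK : Jp *m Jp = - 1%:M) (JmK : Jm *m Jm = - 1%:M).
Hypotheses (JpK' : Jp' *m Jp' = - 1%:M) (JmK' : Jm' *m Jm' = - 1%:M).
Hypothesis G_unit : G \in unitmx.

(** In the application A = D^T (2g)^-1 and G is (2g)^-1 at the image point, so this says that D
    pushes forward the bivectors g^-1 J+ / 2 and g^-1 J- / 2. *)
Let transports := A *m Jp *m D = G *m Jp' /\ A *m Jm *m D = G *m Jm'.
Let intertwines := Jm *m Jp *m D = D *m (Jm' *m Jp').

Lemma transports_of_add_sub :
  A *m (Jp - Jm) *m D = G *m (Jp' - Jm') ->
  A *m (Jp + Jm) *m D = G *m (Jp' + Jm') -> transports.
Proof.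
rewrite !mulmxBr !mulmxDr !mulmxBl !mulmxDl => hB hD.
have inj2 (X Y : 'M[K]_n) : X + X = Y + Y -> X = Y.
  by rewrite -!mulr2n -!scaler_nat => /(scalerI two_neq0).
have double_l (X Y : 'M[K]_n) : X + X = (X - Y) + (X + Y).
  by rewrite addrCA subrK.
have double_r (X Y : 'M[K]_n) : Y + Y = (X + Y) - (X - Y).
  by rewrite opprB [RHS]addrC addrA subrK.
split; apply: inj2.
  by rewrite (double_l _ (A *m Jm *m D)) hB hD -double_l.
by rewrite (double_r (A *m Jp *m D)) hB hD -double_r.
Qed.

Lemma transports_add_sub : transports ->
  A *m (Jp - Jm) *m D = G *m (Jp' - Jm') /\
  A *m (Jp + Jm) *m D = G *m (Jp' + Jm').
Proof.
by move=> [hp hm]; rewrite !mulmxBr !mulmxDr !mulmxBl !mulmxDl hp hm.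
Qed.

Lemma intertwines_of_transports : transports -> intertwines.
Proof.
move=> [hp hm].
have Jm'u : Jm' \in unitmx.
  have : (- Jm') *m Jm' = 1%:M by rewrite mulNmx JmK' opprK.
  by move=> /mulmx1_unit[].
(* A is a left factor of the invertible product G Jm'. Eliminating G between the two transport
   equations then allows A to be cancelled. *)
have Au : A \in unitmx.
  have : A *m Jm *m D \in unitmx by rewrite hm unitmx_mul G_unit.
  by rewrite !unitmx_mul => /andP[/andP[]].
have GE : G = - (A *m Jm *m D *m Jm').
  by rewrite hm -mulmxA JmK' mulmxN mulmx1 opprK.
have : A *m (Jp *m D) = A *m (- (Jm *m D *m (Jm' *m Jp'))).
  by rewrite mulmxA hp {1}GE mulmxN mulNmx !mulmxA.
move=> /(can_inj (mulKmx Au)) JpD.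
by rewrite /intertwines -mulmxA JpD mulmxN !mulmxA JmK !mulNmx opprK mul1mx.
Qed.

(* The sign c covers both L1 and L2: Jp - c Jm = - Jm (Jm Jp + c). *)
Lemma transports_of_intertwines (c : K) : Jp' - c *: Jm' \in unitmx ->
  A *m (Jp - c *: Jm) *m D = G *m (Jp' - c *: Jm') -> intertwines -> transports.
Proof.
move=> u h QD.
have E (P M : 'M[K]_n) : M *m M = - 1%:M ->
    P - c *: M = - (M *m (M *m P + c *: 1%:M)).
  move=> MM; rewrite mulmxDr mulmxA MM mulNmx mul1mx -scalemxAr mulmx1.
  by rewrite opprD opprK.
have u' : Jm' *m Jp' + c *: 1%:M \in unitmx.
  by move: u; rewrite E // unitmxN unitmx_mul => /andP[].
(* Intertwining moves Jm Jp + c across D to Jm' Jp' + c, which is invertible and can be cancelled on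
   the right. *)
have hm : A *m Jm *m D = G *m Jm'.
  apply: (can_inj (mulmxK u')); rewrite -[RHS]mulmxA.
  apply: oppr_inj; rewrite -[RHS]mulmxN -E // -h E // mulmxN mulNmx.
  congr (- _); rewrite -!mulmxA; congr (A *m (Jm *m _)).
  by rewrite mulmxDl mulmxDr QD -scalemxAl -scalemxAr mul1mx mulmx1.
split=> //.
(* Writing Jp as -Jm (Jm Jp) reduces its transport to that of Jm and the intertwining relation. *)
have JE (P M : 'M[K]_n) : M *m M = - 1%:M -> P = - (M *m (M *m P)).
  by move=> MM; rewrite mulmxA MM mulNmx mul1mx opprK.
rewrite [in LHS](JE Jp Jm JmK) [in RHS](JE Jp' Jm' JmK') !mulmxN mulNmx.
by congr (- _); rewrite [RHS]mulmxA -hm -!mulmxA -QD !mulmxA.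
Qed.

End Intertwining.

(** * The three implications, checked point by point *)

Theorem corollary6p7 (R : realType) (n : nat) (M : manifold R n)
    (L1 L2 : M -> 'M[R[i]]_(n + n)) (g b Jp Jm : M -> 'M[R]_n)
    (kahler : gen_almost_Kahler L1 L2)
    (data : bihermitian_data L1 L2 g b Jp Jm)
    (inv_add : forall p : M, Jp p + Jm p \in unitmx)
    (inv_sub : forall p : M, Jp p - Jm p \in unitmx)
    (phi : M -> M) (diffeo : diffeomorphism phi) :
  let holo1 := gc_holomorphic L1 L1 phi in
  let holo2 := gc_holomorphic L2 L2 phi in
  (* d(phi) o (J+ J-) = (J+ J-) o d(phi); matrices act on row vectors *)
  let commutes := forall p : M,
    (Jm p *m Jp p) *m differential phi p
    = differential phi p *m (Jm (phi p) *m Jp (phi p)) in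
  [/\ (holo1 /\ holo2 -> commutes),
      (holo1 /\ commutes -> holo2) &
      (holo2 /\ commutes -> holo1)].
Proof.
move=> holo1 holo2 commutes.
have [[_ gcs1] [_ gcs2] _] := kahler.
have [[_ gmet] _ [_ herm_p] [_ herm_m] LE] := data.
have JpK p := (herm_p p).1; have JmK p := (herm_m p).1.
have JNK p : (- Jm p) *m (- Jm p) = - 1%:M by rewrite mulmxN mulNmx opprK.
have iso1 p : isotropic (L1 p) by have [[]] := gcs1 p.
have iso2 p : isotropic (L2 p) by have [[]] := gcs2 p.
have inv_addN p : Jp p - - Jm p \in unitmx by rewrite opprK.
have hE p : b p + g p - (b p - g p) = 2 *: g p.
  by rewrite opprB addrC addrA subrK scaler_nat mulr2n.
have two0 : (2 : R) != 0 by rewrite pnatr_eq0.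
have hu p : b p + g p - (b p - g p) \in unitmx.
  by rewrite hE unitmxZ ?unitfE // posdef_unitmx //; case: (gmet p).
have L1E p : (L1 p == eigen_graph (Jp p) (b p + g p)
    + eigen_graph (Jm p) (b p - g p))%MS by case: (LE p).
have L2E p : (L2 p == eigen_graph (Jp p) (b p + g p)
    + eigen_graph (- Jm p) (b p - g p))%MS.
  have [_ _ /eqmxP L2E _] := LE p; apply/eqmxP; apply: eqmx_trans L2E _.
  exact: adds_eqmx (eqmx_refl _) (conj_eigen_graph _ _ _ (JmK p)).
pose D := differential phi.
(* By [hE] the inverted matrix is 2g; it is kept as a difference to match h1 - h2 in
   [gc_linear_eigen_graphs]. *)
pose A p := (D p)^T *m invmx (b p + g p - (b p - g p)).
pose G p := invmx (b (phi p) + g (phi p) - (b (phi p) - g (phi p))).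
have Gu p : G p \in unitmx by rewrite unitmx_inv.
have lin1 p : gc_linear (L1 p) (L1 (phi p)) (D p) <->
    A p *m (Jp p - Jm p) *m D p = G p *m (Jp (phi p) - Jm (phi p)).
  exact: gc_linear_eigen_graphs.
have lin2 p : gc_linear (L2 p) (L2 (phi p)) (D p) <->
    A p *m (Jp p + Jm p) *m D p = G p *m (Jp (phi p) + Jm (phi p)).
  rewrite -{1}[Jm p]opprK -[Jm (phi p)]opprK.
  exact: gc_linear_eigen_graphs.
split.
- move=> [[_ H1] [_ H2]] p.
  apply: (intertwines_of_transports _ _ _ _ (A p) _ (G p)) => //.
  by apply: transports_of_add_sub => //; [apply/lin1 | apply/lin2].
- move=> [[sm H1] C]; split=> // p; apply/lin2.
  apply: (transports_add_sub _ _ _ _ _ _ _ _).2.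
  (* The sign c = 1 corresponds to J+ - J-, hence to L1; c = -1 in the last case corresponds to J+ +
     J-, hence to L2. *)
  apply: (transports_of_intertwines _ _ _ _ _ _ _ _ _ 1); rewrite ?scale1r //.
  exact/lin1.
- move=> [[sm H2] C]; split=> // p; apply/lin1.
  apply: (transports_add_sub _ _ _ _ _ _ _ _).1.
  apply: (transports_of_intertwines _ _ _ _ _ _ _ _ _ (-1));
    rewrite ?scaleN1r ?opprK //.
  exact/lin2.
Qed.
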